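(* Let $A:\mathbb{R}^n\to\mathbb{R}^n$ be a $C^1$ monotone map, that is, $(A(x)-A(y))\cdot(x-y)\ge0$ for all $x,y\in\mathbb{R}^n$, for which there exist two constants $R\ge0$ and $K>0$ such that $\nabla^SA(x)\ge K\,\mathrm{Id}_n$ for all $|x|\ge R$. Let $d\nu=e^{-V}dx$ be a probability measure in $\mathcal{P}_2(\mathbb{R}^n)$, with $V:\mathbb{R}^n\to\mathbb{R}$ a $C^1$ potential. Then there is a constant $C=C(V,R,K)>0$ (depending on $V$, $R$, $K$ and the dimension $n$) such that $(\nu,A)$ satisfies a $WJ$ inequality with constant $C$.
   Context: $\mathcal{P}_2(\mathbb{R}^n)$ is the set of probability measures on $\mathbb{R}^n$ with finite second moment, $\mathcal{P}_{2,c}(\mathbb{R}^n)$ is the set of those having a $C^1$ positive density on $\mathbb{R}^n$, and $W_2$ is the quadratic Wasserstein distance. For a $C^1$ vector field $A$, $\nabla^SA=(\nabla A+\nabla A^T)/2$ is the symmetric part of its Jacobian matrix. $WJ$ inequality: for $\nu\in\mathcal{P}_{2,c}(\mathbb{R}^n)$ and $A$ a $C^1$ vector field, $(\nu,A)$ satisfies a $WJ$ inequality with constant $C>0$ (written $WJ(C)$) if $W_2(\nu,\mu)\le\sqrt{\frac1C J(\mu|(\nu,A))}$ for every $\mu\in\mathcal{P}_{2,c}(\mathbb{R}^n)$, where $$J(\mu|(\nu,A))=\int\big[\Delta\varphi(x)+\Delta\varphi^*(\nabla\varphi(x))-2n+(A(\nabla\varphi(x))-A(x))\cdot(\nabla\varphi(x)-x)\big]d\nu(x)$$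 and $\nabla\varphi\#\nu=\mu$ is the Brenier map ($\varphi$ convex), $\varphi^*(q)=\sup_x\{q\cdot x-\varphi(x)\}$. It is part of the definition that $J(\mu|(\nu,A))$ is well defined and non-negative (value $+\infty$ allowed). By Caffarelli's regularity theory, for $\nu,\mu\in\mathcal{P}_{2,c}(\mathbb{R}^n)$ both $\varphi$ and $\varphi^*$ are $C^2$ and strictly convex on $\mathbb{R}^n$. *)

(* Defs.v *)
From HB Require Import structures.
From mathcomp Require Import all_boot all_order all_algebra.
From mathcomp Require Import all_classical all_reals all_analysis.
From mathcomp Require Import measurable_realfun.

Set Implicit Arguments.
Unset Strict Implicit.
Unset Printing Implicit Defensive.
Import Order.TTheory GRing.Theory Num.Theory.
Import numFieldNormedType.Exports.

Local Open Scope classical_set_scope.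
Local Open Scope ring_scope.

(* Matrices (hence row vectors, the elements of R^n) carry their Borel
   sigma-algebra. *)
Definition measure_matrix_display : measure_display.
Proof. exact: default_measure_display. Qed.

Section borel_matrix.
Context {R : realType} {m n : nat}.
Local Notation M := 'M[R]_(m, n).

Let borel := <<s @open M >>.

Let borel0 : borel set0. Proof. exact: sigma_algebra0. Qed.

Let borelC (A : set M) : borel A -> borel (~` A).
Proof. exact: sigma_algebraC. Qed.

Let borel_bigcup (F : (set M)^nat) :
  (forall i, borel (F i)) -> borel (\bigcup_i F i).
Proof. exact: sigma_algebra_bigcup. Qed.

HB.instance Definition _ := @isMeasurable.Build measure_matrix_display
  (matrix R m n) borel borel0 borelC borel_bigcup.

Lemma borel_matrixE : @measurable _ M = <<s @open M >>.
Proof. by []. Qed.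

End borel_matrix.

Section measurable_rV.
Context {R : realType}.

Lemma open_rV_bigcup n (O : set 'rV[R]_n) : open O ->
  O = \bigcup_(q in [set q : 'rV[rat]_n * nat |
        ball (map_mx ratr q.1 : 'rV[R]_n) q.2.+1%:R^-1 `<=` O])
        ball (map_mx ratr q.1 : 'rV[R]_n) q.2.+1%:R^-1.
Proof.
move=> oO; apply/seteqP; split=> [x Ox|x [q qO xq]]; last exact: qO.
have /nbhs_ballP[e /= e0 eO] : nbhs x O by exact: open_nbhs_nbhs.
have [k ke] : exists k : nat, k.+1%:R^-1 < e / 2.
  exists (Num.truncn (e / 2)^-1).
  by rewrite invf_plt ?posrE ?divr_gt0// truncnS_gt.
have k0 : 0 < k.+1%:R^-1 :> R by [].
have xq i : exists q : rat, `|x ord0 i - ratr q| < k.+1%:R^-1.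
  have : x ord0 i - k.+1%:R^-1 < x ord0 i + k.+1%:R^-1.
    by rewrite ltrD2l gtrN.
  move=> /rat_in_itvoo[q]; rewrite in_itv/= => /andP[q1 q2]; exists q.
  by rewrite distrC ltr_distl q1 q2.
pose q := \row_i projT1 (cid (xq i)).
have qx : ball (map_mx ratr q : 'rV[R]_n) k.+1%:R^-1 x.
  split=> // i j; rewrite !mxE /ball/= distrC ord1.
  exact: (projT2 (cid (xq j))).
exists (q, k) => //= y qy; apply: eO.
apply: (@le_ball _ _ _ (k.+1%:R^-1 + k.+1%:R^-1)).
  by rewrite [leRHS]splitr lerD// ltW.
by apply: ball_triangle qy; exact: ball_sym.
Qed.

Lemma measurable_fun_rV d (T : measurableType d) n (f : T -> 'rV[R]_n) :
  (forall i, measurable_fun [set: T] (fun x => f x ord0 i)) ->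
  measurable_fun [set: T] f.
Proof.
move=> mf; apply: (measurability (@open 'rV[R]_n)) => //.
move=> _ [U oU <-]; rewrite setTI (open_rV_bigcup oU) preimage_bigcup.
rewrite bigcup_mkcond.
apply: countable_bigcupT_measurable => // q; case: ifP => // _.
rewrite (_ : _ @^-1` _ = ~` \bigcup_(i in [set: 'I_n]) ~`
   ((fun x => f x ord0 i) @^-1` ball (ratr (q.1 ord0 i) : R) q.2.+1%:R^-1)).
  apply: measurableC; apply: countable_bigcupT_measurable => // i.
  apply: measurableC; rewrite -[X in measurable X]setTI.
  by apply: mf => //; apply: open_measurable; exact: ball_open.
rewrite setC_bigcup; under eq_bigcapr do rewrite setCK.
apply/seteqP; split => x /=.
  by move=> [_ qf] i _ /=; have := qf ord0 i; rewrite mxE.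
by move=> qf; split => // i j; rewrite mxE ord1; exact: qf.
Qed.

Lemma measurable_coord_rV n (i : 'I_n) :
  measurable_fun [set: 'rV[R]_n] (fun x => x ord0 i).
Proof.
apply: (measurability _ (RGenOpens.measurableE R)).
move=> _ [_ [a [b ->] <-]]; rewrite setTI; apply: sub_sigma_algebra.
apply: open_comp (interval_open _ _) => // x _; exact: coord_continuous.
Qed.

Definition rV_cons n (x : measurableTypeR R * 'rV[R]_n) : 'rV[R]_n.+1 :=
  \row_i if unlift ord0 i is Some j then x.2 ord0 j else x.1.

Definition rV_uncons n (x : 'rV[R]_n.+1) :
    measurableTypeR R * 'rV[R]_n :=
  (x ord0 ord0, \row_i x ord0 (lift ord0 i)).

Lemma rV_consK n : cancel (@rV_cons n) (@rV_uncons n).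
Proof.
move=> [a v]; rewrite /rV_cons /rV_uncons/=; congr pair.
  by rewrite mxE unlift_none.
by apply/rowP => i; rewrite !mxE liftK.
Qed.

Lemma rV_unconsK n : cancel (@rV_uncons n) (@rV_cons n).
Proof.
move=> v; rewrite /rV_cons /rV_uncons/=; apply/rowP => i; rewrite !mxE.
by case: unliftP => [j ->|->] //; rewrite mxE.
Qed.

Lemma measurable_rV_cons n : 
  measurable_fun [set: measurableTypeR R * 'rV[R]_n] (@rV_cons n).
Proof.
apply: measurable_fun_rV => i; rewrite /rV_cons.
under eq_fun do rewrite mxE.
case: (unlift ord0 i) => [j|]; last exact: measurable_fst.
exact: (measurableT_comp (measurable_coord_rV j)).
Qed.

Lemma measurable_rV_uncons n : measurable_fun [set: 'rV[R]_n.+1] (@rV_uncons n).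
Proof.
apply/measurable_fun_pairP; split; first exact: measurable_coord_rV.
apply: measurable_fun_rV => i.
under eq_fun do rewrite /= mxE.
exact: measurable_coord_rV.
Qed.

End measurable_rV.

Section lebesgue_rV.
Context {R : realType}.
Local Open Scope ereal_scope.

Section step.
Context {n : nat} (l : {sigma_finite_measure set 'rV[R]_n -> \bar R}).

(* the product of the Lebesgue measure on R with l, transported to R^(n+1) *)
Definition lebesgue_rV_step : set 'rV[R]_n.+1 -> \bar R :=
  pushforward (@lebesgue_measure R \x l) (@rV_cons R n).

Let step0 : lebesgue_rV_step set0 = 0.
Proof. by rewrite /lebesgue_rV_step /pushforward preimage_set0 measure0. Qed.

Let measurable_step A : measurable A -> measurable (@rV_cons R n @^-1` A).
Proof.
by move=> mA; rewrite -[X in measurable X]setTI; exact: measurable_rV_cons.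
Qed.

Let step_ge0 A : 0 <= lebesgue_rV_step A.
Proof. exact: (measure_ge0 (@lebesgue_measure R \x l)). Qed.

Let step_sigma_additive : semi_sigma_additive lebesgue_rV_step.
Proof.
move=> F mF tF mUF; rewrite /lebesgue_rV_step /pushforward preimage_bigcup.
apply: (measure_semi_sigma_additive (s := @lebesgue_measure R \x l)).
- by move=> k; exact: measurable_step.
- apply/trivIsetP => i j _ _ ij; rewrite -preimage_setI.
  move/trivIsetP : tF => /(_ i j Logic.I Logic.I ij) ->.
  by rewrite preimage_set0.
- by rewrite -preimage_bigcup; exact: measurable_step.
Qed.

HB.instance Definition _ := isMeasure.Build _ _ _ lebesgue_rV_step
  step0 step_ge0 step_sigma_additive.

Let step_sigma_finite : sigma_finite setT lebesgue_rV_step.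
Proof.
have /sigma_finiteP[F [TF ndF Foo]] := sigma_finiteT (@lebesgue_measure R).
have /sigma_finiteP[G [TG ndG Goo]] := sigma_finiteT l.
exists (fun k => @rV_uncons R n @^-1` (F k `*` G k)).
  rewrite -preimage_bigcup; apply/seteqP; split => // x _ /=.
  have [i _ Fi] : (\bigcup_k F k) (rV_uncons x).1 by rewrite -TF.
  have [j _ Gj] : (\bigcup_k G k) (rV_uncons x).2 by rewrite -TG.
  exists (maxn i j) => //; split.
  - by move: Fi; apply/subsetPset/ndF/leq_maxl.
  - by move: Gj; apply/subsetPset/ndG/leq_maxr.
move=> k; have [mF Fk] := Foo k; have [mG Gk] := Goo k.
have mFG : measurable (F k `*` G k) by exact: measurableX.
split; first by rewrite -[X in measurable X]setTI; exact: measurable_rV_uncons.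
rewrite /lebesgue_rV_step /pushforward -comp_preimage.
rewrite (_ : _ @^-1` _ = F k `*` G k); last first.
  by rewrite (_ : _ \o _ = id)//; apply/funext => x; exact: rV_consK.
by rewrite product_measure1E// lte_mul_pinfty// ge0_fin_numE.
Qed.

HB.instance Definition _ := Measure_isSigmaFinite.Build _ _ _ lebesgue_rV_step
  step_sigma_finite.

End step.

Fixpoint lebesgue_rV n : {sigma_finite_measure set 'rV[R]_n -> \bar R} :=
  if n is k.+1 then [the {sigma_finite_measure set _ -> \bar R} of
    lebesgue_rV_step (lebesgue_rV k)]
  else [the {sigma_finite_measure set _ -> \bar R} of dirac (0%R : 'rV[R]_0)].

Lemma lebesgue_rV_box n (a b : 'I_n -> R) : (forall i, a i <= b i)%R ->
  lebesgue_rV n [set x | forall i, x ord0 i \in `[a i, b i]]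
  = (\prod_(i < n) (b i - a i))%:E.
Proof.
elim: n a b => [|n IH] a b ab.
  by rewrite big_ord0 /= diracE mem_set// => -[].
rewrite /= /lebesgue_rV_step /pushforward.
rewrite (_ : _ @^-1` _ = `[a ord0, b ord0]%classic `*`
    [set x : 'rV[R]_n | forall i,
      x ord0 i \in `[a (lift ord0 i), b (lift ord0 i)]]).
  rewrite product_measure1E//=.
  - rewrite IH//= lebesgue_measure_itv/= lte_fin big_ord_recl EFinM.
    rewrite lt_neqAle ab andbT; case: eqVneq => [->|_]//=.
    by rewrite subrr.
  - rewrite (_ : [set _ | _] = ~` \bigcup_(i in [set: 'I_n])
        ~` ((fun x : 'rV[R]_n => x ord0 i) @^-1`
           `[a (lift ord0 i), b (lift ord0 i)]%classic)).
      apply: measurableC; apply: countable_bigcupT_measurable => // i.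
      apply: measurableC; rewrite -[X in measurable X]setTI.
      by apply: measurable_coord_rV => //; exact: measurable_itv.
    rewrite setC_bigcup; under eq_bigcapr do rewrite setCK.
    by apply/seteqP; split => x /= h i; have := h i; [|exact].
apply/seteqP; split => -[x v] /=.
  move=> h; have xv := rV_consK (x, v); rewrite /rV_uncons in xv.
  have [x0 vE] := xv; rewrite -{1}x0; split; first exact: h.
  by move=> i; rewrite -vE mxE; exact: h.
move=> [hx hv] i; have [x0 vE] := rV_consK (x, v).
have [->|] := eqVneq i ord0; first by rewrite x0.
by rewrite eq_sym => /unlift_some[j -> _]; have := hv j; rewrite -{1}vE mxE.
Qed.

End lebesgue_rV.

(* R^n is 'rV[R]_n. The library norm of a matrix is the sup norm, which gives
   the usual topology and differentials, but the |x| of the statements below is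
   the Euclidean norm enorm. *)
Section calculus.
Context {R : realType} {n : nat}.
Implicit Types (x y u v : 'rV[R]_n) (f : 'rV[R]_n -> R).

Definition dotv u v : R := (u *m v^T) 0 0.

Definition enorm u : R := Num.sqrt (dotv u u).

Definition C1 (W : normedModType R) (f : 'rV[R]_n -> W) : Prop :=
  (forall x, differentiable f x) /\
  (forall v, continuous (fun x => 'D_v f x)).

Definition grad f x : 'rV[R]_n := \row_i 'D_(delta_mx 0 i) f x.

Definition C2 f : Prop := C1 f /\ C1 (grad f).

Definition laplacian f x : R :=
  \sum_(i < n) 'D_(delta_mx 0 i) (fun y => 'D_(delta_mx 0 i) f y) x.

(* 'J is the transpose of the usual Jacobian matrix, as vectors are rows. *)
Definition sym_jacobian (A : 'rV[R]_n -> 'rV[R]_n) x : 'M[R]_n :=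
  2^-1 *: ('J A x + ('J A x)^T).

(* M <= N in the order of quadratic forms *)
Definition mx_form_le (M N : 'M[R]_n) : Prop :=
  forall v, dotv (v *m M) v <= dotv (v *m N) v.

Definition monotone_map (A : 'rV[R]_n -> 'rV[R]_n) : Prop :=
  forall x y, 0 <= dotv (A x - A y) (x - y).

Definition strictly_convex f : Prop :=
  forall x y (t : R), x != y -> 0 < t -> t < 1 ->
    f (t *: x + (1 - t) *: y) < t * f x + (1 - t) * f y.

(* the supremum of q . x - f x over x, possibly +oo *)
Definition conjugate f (q : 'rV[R]_n) : \bar R :=
  ereal_sup [set (dotv q x - f x)%:E | x in [set: 'rV[R]_n]].

(* only meaningful when conjugate f is finite *)
Definition conjugateR f (q : 'rV[R]_n) : R := fine (conjugate f q).

End calculus.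

Section transport.
Context {R : realType} {n : nat}.
Local Open Scope ereal_scope.
Local Notation E := 'rV[R]_n.
Implicit Types (mu nu : probability E R) (phi : E -> R) (A : E -> E).

Definition finite_second_moment mu : Prop :=
  \int[mu]_x (dotv x x)%:E < +oo.

Definition has_density mu (f : E -> R) : Prop :=
  forall B, measurable B -> mu B = \int[lebesgue_rV n]_(x in B) (f x)%:E.

Definition P2c mu : Prop :=
  finite_second_moment mu /\
  exists f : E -> R, [/\ C1 f, (forall x, (0 < f x)%R) & has_density mu f].

Definition coupling mu nu (pi : probability (E * E)%type R) : Prop :=
  forall B, measurable B ->
    pushforward pi fst B = mu B /\ pushforward pi snd B = nu B.

Definition W2 mu nu : \bar R :=
  sqrte (ereal_inf [set \int[pi]_z (dotv (z.1 - z.2) (z.1 - z.2))%R%:E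
    | pi in [set pi | coupling mu nu pi]]).

Definition brenier_potential nu mu phi : Prop :=
  [/\ convex_function [set: E] phi,
      (forall x, differentiable phi x) &
      forall B, measurable B -> pushforward nu (grad phi) B = mu B].

(* For nu and mu in P2c, Caffarelli's theory gives this for any Brenier
   potential from nu to mu; it is what gives a meaning to the Laplacians in J.
   Any two such potentials differ by a constant, on which J does not depend. *)
Definition caffarelli_regular phi : Prop :=
  [/\ C2 phi, strictly_convex phi,
      (forall q, conjugate phi q \is a fin_num),
      C2 (conjugateR phi) & strictly_convex (conjugateR phi)].

Definition J_integrand A phi (x : E) : R :=
  (laplacian phi x + laplacian (conjugateR phi) (grad phi x) - 2 * n%:R
   + dotv (A (grad phi x) - A x) (grad phi x - x))%R.

(* J(mu|(nu, A)), where phi is a Brenier potential from nu to mu *)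
Definition J nu A phi : \bar R := \int[nu]_x (J_integrand A phi x)%:E.

(* The integral of f has a value in [-oo, +oo]. This has to be required
   separately since the library gives a value to +oo - oo. *)
Definition integral_defined nu (f : E -> \bar R) : Prop :=
  measurable_fun [set: E] f /\
  (\int[nu]_x f^\+ x < +oo \/ \int[nu]_x f^\- x < +oo).

Definition WJ nu A (C : R) : Prop :=
  forall mu phi, P2c mu -> brenier_potential nu mu phi ->
    caffarelli_regular phi ->
    [/\ integral_defined nu (fun x => (J_integrand A phi x)%:E),
        0 <= J nu A phi &
        W2 nu mu <= sqrte (C^-1%:E * J nu A phi)].

End transport.

(* Main.v *)
Require Import Defs.
From HB Require Import structures.
From mathcomp Require Import all_boot all_order all_algebra.
From mathcomp Require Import all_classical all_reals all_analysis.
From mathcomp Require Import measurable_realfun lra ring.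
Import Order.TTheory GRing.Theory Num.Theory.
Import numFieldNormedType.Exports.
Local Open Scope classical_set_scope.
Local Open Scope ring_scope.

(* Write T = grad phi, h = T - id, m = (A(T) - A) . h. The map (id, T) is a
   coupling, so it suffices to bound the integral of |h|^2 against nu by a
   multiple of J.

   If |x| >= 2r or |T x| >= 2r, then the first or the last quarter of the
   segment [x, T x] is outside the ball of radius r, so |h|^2 <= (4/K) m by
   monotonicity. The remaining points x are bounded, and there |h| <= 4r.

   For them, move along the i-th axis from x to a point y at distance about 2r
   from the origin, where h_i(y)^2 <= (4/K) m(y). Since
   (D^2 phi)^-1 has i-th diagonal entry at least 1/a with a = d_ii phi, the
   Laplacian part of J dominates a + 1/a - 2, hence, for all d,
   d (2 - d) (a - 1) <= (a + 1/a - 2) + d^2. Integrating this along the segment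
   with d proportional to h_i(y) - h_i(x), which is bounded, gives
   (h_i(y) - h_i(x))^2 <= C int (a + 1/a - 2). Averaging over y, integrating
   over all lines (Tonelli) and comparing e^-V with constants on a cube gives
   the result. *)

(** * Derivatives along lines and second-order condition at a minimum *)

(** Only derivability in the direction [v] is asked, so that the lemma also applies to the partial
    derivatives of a potential, through [derivable_grad]. *)
Lemma is_derive_line {R : realType} {V W : normedModType R} (f : V -> W)
    (x v : V) (t : R) : derivable f (t *: v + x) v ->
  is_derive t 1 (fun s : R => f (s *: v + x)) ('D_v f (t *: v + x)).
Proof.
have E : (fun h : R => h^-1 *: (((fun s : R => f (s *: v + x)) \o shift t) (h *: 1)
      - f (t *: v + x))) =
    (fun h => h^-1 *: ((f \o shift (t *: v + x)) (h *: v) - f (t *: v + x))).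
  by apply/funext => h /=; rewrite [h *: 1]mulr1 scalerDl addrA.
by move=> df; apply: DeriveDef; rewrite /derivable /derive E.
Qed.

Lemma derive_lt0_right {R : realType} (w : R -> R) (d : R) :
  is_derive (0 : R) 1 w d -> d < 0 ->
  exists2 e : R, 0 < e & forall t, 0 < t < e -> w t < w 0.
Proof.
move=> hw dn.
have c : (fun h : R => h^-1 *: ((w \o shift 0) (h *: 1) - w 0)) @ 0^' --> d.
  by rewrite -(@derive_val _ _ _ _ _ _ _ hw); exact: (@ex_derive _ _ _ _ _ _ _ hw).
move/cvgr_lt: c => /(_ 0 dn).
rewrite near_withinE => /nbhs_ballP [e /= e0 he]; exists e => // t /andP[t0 te].
have := he t; rewrite /ball/= sub0r normrN gtr0_norm// => /(_ te (lt0r_neq0 t0)).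
rewrite addr0 [t *: 1]mulr1 [_ *: _]/( _ * _) pmulr_rlt0 ?invr_gt0//.
by rewrite subr_lt0.
Qed.

(** The derivative [du] vanishes at the minimum 0. If [d2] were negative, [du] would be negative
    just to the right of 0, and the mean value theorem would give a value of [u] below [u 0]. *)
Lemma derive2_at_min_ge0 {R : realType} (u du : R -> R) (d2 : R) :
  (forall t : R, is_derive t 1 u (du t)) -> is_derive (0 : R) 1 du d2 ->
  (forall t, u 0 <= u t) -> 0 <= d2.
Proof.
move=> hu hdu umin; rewrite leNgt; apply/negP => d2n.
have du0 : du 0 = 0.
  have h0 : (0:R) \in `]-1, 1[ by rewrite in_itv/= ltrN10 ltr01.
  have : is_derive (0:R) 1 u 0.
    by apply: (@derive1_at_min _ _ (-1) 1) => //.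
  by move=> H; rewrite -(@derive_val _ _ _ _ _ _ _ (hu 0)) (@derive_val _ _ _ _ _ _ _ H).
have [e e0 he] := derive_lt0_right _ _ hdu d2n.
have e2 : 0 < e/2 by rewrite divr_gt0.
have [z] : exists2 c, c \in `]0, e/2[ & u (e/2) - u 0 = du c * (e/2 - 0).
  apply: MVT => //.
  by apply: derivable_within_continuous => t _; exact: ex_derive.
rewrite in_itv/= subr0 => /andP[z0 ze] E.
have : du z < 0 by rewrite -du0; apply: he; lra.
have := umin (e/2); nra.
Qed.

(** * Scalar product, gradient and second partial derivatives *)

Lemma dotvE {R : realType} {n} (u v : 'rV[R]_n) :
  dotv u v = \sum_i u ord0 i * v ord0 i.
Proof. by rewrite /dotv mxE; apply: eq_bigr => i _; rewrite mxE. Qed.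

Lemma dotvC {R : realType} {n} (u v : 'rV[R]_n) : dotv u v = dotv v u.
Proof. by rewrite !dotvE; apply: eq_bigr => i _; rewrite mulrC. Qed.

Lemma dotvDl {R : realType} {n} (u v w : 'rV[R]_n) :
  dotv (u + v) w = dotv u w + dotv v w.
Proof. by rewrite /dotv mulmxDl mxE. Qed.

Lemma dotvBl {R : realType} {n} (u v w : 'rV[R]_n) :
  dotv (u - v) w = dotv u w - dotv v w.
Proof. by rewrite /dotv mulmxBl !mxE. Qed.

Lemma dotvZl {R : realType} {n} (k : R) (u v : 'rV[R]_n) :
  dotv (k *: u) v = k * dotv u v.
Proof. by rewrite /dotv -scalemxAl mxE. Qed.

Lemma dotv_delta {R : realType} {n} (u : 'rV[R]_n) i :
  dotv (delta_mx 0 i) u = u ord0 i.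
Proof.
rewrite dotvE (bigD1 i)//= mxE !eqxx mul1r big1 ?addr0// => j ji.
by rewrite mxE (negbTE ji) andbF mul0r.
Qed.

Lemma dotv_grad {R : realType} {n} (f : 'rV[R]_n -> R) (x v : 'rV[R]_n) :
  differentiable f x -> dotv (grad f x) v = 'D_v f x.
Proof.
move=> df; rewrite deriveE// [v in RHS]row_sum_delta linear_sum dotvE.
by apply: eq_bigr => i _; rewrite linearZ/= -deriveE// mxE [RHS]mulrC.
Qed.

Lemma derivable_grad {R : realType} {n} (f : 'rV[R]_n -> R) (x v : 'rV[R]_n) i :
  C1 (grad f) -> derivable (fun y => 'D_(delta_mx 0 i) f y) x v.
Proof.
move=> [df _]; have : derivable (grad f) x v by exact: diff_derivable.
move=> /derivable_mxP/(_ ord0 i).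
rewrite (_ : (fun y => _) = (fun y => 'D_(delta_mx 0 i) f y))//.
by apply/funext => y; rewrite mxE.
Qed.

Lemma derive_gradE {R : realType} {n} (f : 'rV[R]_n -> R) (x v : 'rV[R]_n) i :
  C1 (grad f) ->
  'D_v (fun y => 'D_(delta_mx 0 i) f y) x = 'D_v (grad f) x ord0 i.
Proof.
move=> [df _]; rewrite derive_mx; last exact: diff_derivable.
rewrite mxE; congr ('D_v _ x); apply/funext => y; by rewrite mxE.
Qed.

(** * Convex conjugate and its curvature *)

(** Along the segment from [x] to [y], the gap [w] between the chord and the graph vanishes at 0 and
    is positive inside, so its derivative at 0 cannot be negative. *)
Lemma convex_above_tangent {R : realType} {n} (f : 'rV[R]_n -> R)
    (x y : 'rV[R]_n) :
  strictly_convex f -> differentiable f x ->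
  f x + dotv (grad f x) (y - x) <= f y.
Proof.
move=> cf df; rewrite dotv_grad//.
have [->|xy] := eqVneq x y; first by rewrite subrr derive0 addr0.
pose w (t : R) := (f x + t * (f y - f x)) - f (t *: (y - x) + x).
have hw : is_derive (0 : R) 1 w ((f y - f x) - 'D_(y - x) f x).
  have h1 : is_derive (0 : R) 1 (fun s : R => f (s *: (y - x) + x)) ('D_(y - x) f x).
    by have := is_derive_line f x (y - x) 0; rewrite scale0r add0r; apply; exact: diff_derivable.
  rewrite /w; apply: is_derive_eq.
  by rewrite /GRing.scale/=; ring.
suff : 0 <= (f y - f x) - 'D_(y - x) f x by lra.
rewrite leNgt; apply/negP => /(derive_lt0_right _ _ hw)[e e0 he].
pose t := Num.min (e / 2) (1 / 2).
have t0 : 0 < t by rewrite /t lt_min !divr_gt0.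
have te : t <= e / 2 by rewrite /t ge_min lexx.
have t1 : t <= 1 / 2 by rewrite /t ge_min lexx orbT.
have /he : 0 < t < e by lra.
rewrite /w scale0r !add0r mul0r addr0 subrr.
have := cf y x t; rewrite eq_sym => /(_ xy t0).
have -> : t *: y + (1 - t) *: x = t *: (y - x) + x.
  by rewrite scalerBr scalerBl scale1r addrA addrAC.
have t1' : t < 1 by lra.
by move=> /(_ t1'); nra.
Qed.

(** The Fenchel-Young inequality; finiteness ensures that [fine] returns the actual supremum. *)
Lemma conjugate_ge {R : realType} {n} (f : 'rV[R]_n -> R) (x q : 'rV[R]_n) :
  conjugate f q \is a fin_num -> dotv q x - f x <= conjugateR f q.
Proof.
move=> fq; rewrite -lee_fin /conjugateR fineK//.
by apply: ereal_sup_ubound => /=; exists x.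
Qed.

(** The equality case of Fenchel-Young: by the tangent inequality, the supremum defining the
    conjugate at [grad f x] is attained at [x]. *)
Lemma conjugate_grad {R : realType} {n} (f : 'rV[R]_n -> R) (x : 'rV[R]_n) :
  strictly_convex f -> differentiable f x ->
  conjugateR f (grad f x) = dotv (grad f x) x - f x.
Proof.
move=> cf df; rewrite /conjugateR.
suff -> : conjugate f (grad f x) = (dotv (grad f x) x - f x)%:E by [].
apply/eqP; rewrite eq_le; apply/andP; split; last first.
  by apply: ereal_sup_ubound => /=; exists x.
apply: ge_ereal_sup => _ [y _ <-]; rewrite lee_fin.
have := convex_above_tangent f x y cf df.
by rewrite dotvC dotvBl !(dotvC _ (grad f x)); lra.
Qed.

(* [2c - c^2 a <= b] for all [c] encodes [b >= 1/a], that is, the diagonal part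
   of the inequality D^2 f* (grad f) >= (D^2 f)^-1. It comes from comparing
   f*(q + t e) with the affine functions given by the points x + c t e. *)
Lemma conjugate_curvature {R : realType} {n} (f : 'rV[R]_n -> R)
    (x : 'rV[R]_n) (i : 'I_n) (c : R) :
  caffarelli_regular f ->
  c *+ 2 - c ^+ 2 * 'D_(delta_mx 0 i) (fun y => 'D_(delta_mx 0 i) f y) x <=
  'D_(delta_mx 0 i) (fun y => 'D_(delta_mx 0 i) (conjugateR f) y) (grad f x).
Proof.
move=> [[C1f C1g] cf ffin [C1s C1gs] _].
set s := conjugateR f; set q := grad f x; set e : 'rV[R]_n := delta_mx 0 i.
pose Df y := 'D_e f y; pose Ds y := 'D_e s y.
(* The Fenchel-Young gap between the points [q + t e] and [x + c t e], with their scalar product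
   expanded. It is nonnegative and vanishes at [t = 0], so its second derivative there is
   nonnegative, which is the claim. *)
pose u (t : R) := s (t *: e + q) + f ((c * t) *: e + x)
  - (dotv q x + t * (x ord0 i + c * q ord0 i) + c * t ^+ 2).
pose du (t : R) := Ds (t *: e + q) + c * Df ((c * t) *: e + x)
  - (x ord0 i + c * q ord0 i + c * t *+ 2).
have hct (t : R) : is_derive t 1 (fun t : R => c * t) c.
  by apply: is_derive_eq; rewrite /GRing.scale/=; ring.
have gen (p p' : R) : 0 <= p' + c ^+ 2 * p - c *+ 2 -> c *+ 2 - c ^+ 2 * p <= p'.
  by lra.
apply: gen; rewrite -/Df -/Ds.
apply: (@derive2_at_min_ge0 _ u du) => [t||t].
- have hf : is_derive (c * t) 1 (fun r : R => f (r *: e + x)) (Df ((c * t) *: e + x)).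
    by apply: is_derive_line; apply: diff_derivable; case: C1f.
  have hs : is_derive t 1 (fun r : R => s (r *: e + q)) (Ds (t *: e + q)).
    by apply: is_derive_line; apply: diff_derivable; case: C1s.
  have hfc := @is_derive1_comp _ (fun r : R => f (r *: e + x)) _ _ _ _ hf (hct t).
  rewrite /u; apply: is_derive_eq.
  by rewrite /du /GRing.scale/=; ring.
- have hf : is_derive (c * 0) 1 (fun r : R => Df (r *: e + x)) ('D_e Df x).
    have := is_derive_line Df x e (c * 0); rewrite mulr0 scale0r add0r.
    by apply; exact: derivable_grad.
  have hs : is_derive (0 : R) 1 (fun r : R => Ds (r *: e + q)) ('D_e Ds q).
    have := is_derive_line Ds q e 0; rewrite scale0r add0r.
    by apply; exact: derivable_grad.
  have hfc := @is_derive1_comp _ (fun r : R => Df (r *: e + x)) _ _ _ _ hf (hct 0).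
  rewrite /du; apply: is_derive_eq.
  by move: ('D_e Df x) ('D_e Ds q) => p p'; rewrite /GRing.scale/=; ring.
- have -> : u 0 = 0.
    rewrite /u mulr0 !scale0r !add0r /s /q conjugate_grad//; last by case: C1f.
    by rewrite expr0n/= !mul0r mulr0; lra.
  have := conjugate_ge f ((c * t) *: e + x) (t *: e + q) (ffin _).
  rewrite dotvDl dotvZl dotv_delta (dotvC q) dotvDl dotvZl dotv_delta (dotvC x).
  have -> : ((c * t) *: e + x) ord0 i = c * t + x ord0 i.
    by rewrite !mxE !eqxx/= mulr1.
  by rewrite /u -/s; lra.
Qed.

(** * Integral estimates in one variable *)

Lemma integral_derive {R : realType} (h h' : R -> R) (x y : R) : x <= y ->
  (forall t : R, is_derive t 1 h (h' t)) -> continuous h' ->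
  (\int[lebesgue_measure]_(t in `[x, y]) (h' t)%:E = (h y - h x)%:E)%E.
Proof.
rewrite le_eqVlt => /predU1P[-> _ _|xy hh ch'].
  by rewrite set_itv1 integral_set1 subrr.
have ch : continuous h.
  by move=> t; apply/differentiable_continuous/derivable1_diffP; exact: ex_derive.
rewrite (continuous_FTC2 xy _ (F := h))//.
- exact: continuous_subspaceT.
- split; first by move=> t _; exact: ex_derive.
  + exact/cvg_at_right_filter/ch.
  + exact/cvg_at_left_filter/ch.
- by move=> t _; rewrite derive1E derive_val.
Qed.

(* [h'] plays the role of [a - 1] and [D] that of [a + b - 2] with
   [b >= 1/a]; [d] is [1 - c] in [b >= 2c - c^2 a]. *)
Lemma sqr_increment_le {R : realType} (M : R) (h h' D : R -> R) (x y : R) :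
  0 < M -> - M <= x <= M -> M <= y <= M *+ 2 ->
  (forall t : R, is_derive t 1 h (h' t)) -> continuous h' ->
  continuous D -> (forall t, 0 <= D t) ->
  (forall t d, d * (2 - d) * h' t <= D t + d ^+ 2) ->
  `|h y - h x| <= M *+ 4 ->
  (((h y - h x) ^+ 2)%R%:E <=
   (M *+ 12)%R%:E * \int[lebesgue_measure]_(t in `[(- (M *+ 2))%R, (M *+ 2)%R]) (D t)%:E)%E.
Proof.
move=> M0 /andP[Mx xM] /andP[My yM] hh ch' cD D0 hD hyx.
set S := (\int[_]_(_ in _) _)%E.
have mD := continuous_measurable_fun cD.
have xy : x <= y := le_trans xM My.
set del := h y - h x.
have I (f : R -> R) : continuous f ->
    (@lebesgue_measure R).-integrable `[x, y] (EFin \o f).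
  move=> cf; apply: continuous_compact_integrable; first exact: segment_compact.
  exact: continuous_subspaceT.
(* The increment bound [4M] gives [|d| <= 1], hence [d (2 - d) del >= d del = 6 M d^2]. As
   [y - x <= 3M], the error term [d^2 (y - x)] costs at most half of this, and [3 M d^2 <= S]
   remains. *)
pose d := del / (M *+ 6).
have key : ((d * (2 - d) * del)%:E <= S + (d ^+ 2 * (y - x))%:E)%E.
  have -> : ((d * (2 - d) * del)%:E =
      \int[lebesgue_measure]_(t in `[x, y]) (d * (2 - d) * h' t)%:E)%E.
    under eq_integral do rewrite EFinM.
    by rewrite integralZl ?integral_derive//; exact: I.
  apply: (@le_trans _ _ (\int[lebesgue_measure]_(t in `[x, y]) (D t + d ^+ 2)%:E)%E).
    apply: le_integral => //.
    - apply: (I (fun t => d * (2 - d) * h' t)) => t.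
      by apply: cvgM; [exact: cvg_cst|exact: ch'].
    - apply: (I (fun t => D t + d ^+ 2)) => t.
      by apply: cvgD; [exact: cD|exact: cvg_cst].
    - by move=> t _; rewrite lee_fin.
  under eq_integral do rewrite EFinD.
  rewrite ge0_integralD//; last 3 first.
  - by move=> t _; rewrite lee_fin.
  - by apply/measurable_EFinP; exact: measurable_funTS.
  - by move=> t _; rewrite lee_fin sqr_ge0.
  apply: leeD.
    apply: ge0_subset_integral => //.
    - by apply/measurable_EFinP; exact: measurable_funTS.
    - by move=> t _; rewrite lee_fin.
    - move=> t /=; rewrite !in_itv/= => /andP[xt ty].
      by apply/andP; split; lra.
  rewrite integral_cst//= lebesgue_measure_itv/= lte_fin.
  case: ifPn => [_|]; first by rewrite -EFinB -EFinM.
  by rewrite mule0 lee_fin => _; rewrite mulr_ge0 ?sqr_ge0 ?subr_ge0.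
have [r Sr r0] : exists2 r, S = r%:E & 0 <= r.
  have : S \is a fin_num.
    apply: integrable_fin_num => //.
    by apply: continuous_compact_integrable; [exact: segment_compact|exact: continuous_subspaceT].
  have : (0 <= S)%E by apply: integral_ge0 => t _; rewrite lee_fin.
  by case: S {key} => // r; rewrite lee_fin => r0 _; exists r.
move: key; rewrite Sr -EFinD -EFinM !lee_fin => key.
have dE : del = d * (M *+ 6) by rewrite divfK// lt0r_neq0// mulrn_wgt0.
have [d1 d2] : d <= 1 /\ -1 <= d.
  move: hyx; rewrite -/del dE ler_norml => /andP[a b].
  by split; rewrite -(ler_pM2r M0); lra.
move: key; have : d * (2 - d) * del >= d * del.
  have : 0 <= M * (d ^+ 2 * (1 - d)).
    by rewrite mulr_ge0 ?(ltW M0)// mulr_ge0 ?sqr_ge0 ?subr_ge0.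
  by rewrite dE; lra.
move=> H1 key.
have : d ^+ 2 * (y - x) <= d ^+ 2 * (M *+ 3).
  by rewrite ler_wpM2l ?sqr_ge0//; lra.
move=> H2.
have dd : d * del = d ^+ 2 * M *+ 6 by rewrite dE; ring.
have : M * (d ^+ 2 * M *+ 3) <= M * r by rewrite ler_wpM2l ?(ltW M0)//; lra.
by rewrite dE; lra.
Qed.

(** Where [F] is nonzero, [h t] is compared with [h y] for each [y] in [[M, 2M]], a range in which
    [m] controls [h]. The comparison is averaged over [y], then integrated over [t] in [[-M, M]].
    The function [F] is a part of [h^2] cut off away from the origin. *)
Lemma integral_line_le {R : realType} (M : R) (F h h' D m : R -> R) :
  0 < M ->
  measurable_fun setT F -> (forall t, 0 <= F t) ->
  (forall t, F t <= h t ^+ 2) ->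
  (forall t, F t != 0 -> `|t| <= M /\ `|h t| <= M *+ 2) ->
  (forall t : R, is_derive t 1 h (h' t)) -> continuous h' ->
  continuous D -> (forall t, 0 <= D t) ->
  (forall t d, d * (2 - d) * h' t <= D t + d ^+ 2) ->
  continuous m -> (forall t, 0 <= m t) ->
  (forall t, M <= t -> h t ^+ 2 <= m t) ->
  (\int[lebesgue_measure]_t (F t)%:E <=
   \int[lebesgue_measure]_(t in `[(- (M *+ 2))%R, (M *+ 2)%R])
     (4 * m t + 48 * M ^+ 2 * D t)%R%:E)%E.
Proof.
move=> M0 mF F0 Fh Fsupp hh ch' cD D0 hD cm m0 hm.
have M0' := ltW M0.
set J := `[(- (M *+ 2))%R, (M *+ 2)%R]%classic.
have mJ : measurable J by exact: measurable_itv.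
have mD := continuous_measurable_fun cD.
have mm := continuous_measurable_fun cm.
have fin (f : R -> R) : continuous f -> (forall t, 0 <= f t) ->
    exists2 r, (\int[lebesgue_measure]_(t in J) (f t)%:E)%E = r%:E & 0 <= r.
  move=> cf f0.
  have : (\int[lebesgue_measure]_(t in J) (f t)%:E)%E \is a fin_num.
    apply: integrable_fin_num => //.
    apply: (@continuous_compact_integrable _ f J).
      exact: segment_compact.
    exact: continuous_subspaceT.
  have : (0 <= \int[lebesgue_measure]_(t in J) (f t)%:E)%E.
    by apply: integral_ge0 => t _; rewrite lee_fin.
  by case: (\int[_]_(_ in _) _)%E => // r; rewrite lee_fin => r0 _; exists r.
have mE (f : R -> R) (B : set R) : continuous f ->
    measurable_fun B (fun t => (f t)%:E).
  move=> cf; apply/measurable_EFinP; apply: measurable_funTS.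
  exact: continuous_measurable_fun.
have [s Ss s0] := fin D cD D0.
have [p Sp p0] := fin m cm m0.
have -> : (\int[lebesgue_measure]_(t in J) (4 * m t + 48 * M ^+ 2 * D t)%R%:E
    = (4 * p + 48 * M ^+ 2 * s)%:E)%E.
  under eq_integral do rewrite EFinD !EFinM.
  have c0 : 0 <= 48 * M ^+ 2 by rewrite mulr_ge0// sqr_ge0.
  rewrite ge0_integralD//; [|
    by move=> t _; rewrite -EFinM lee_fin mulr_ge0|
    by apply/measurable_EFinP; apply: measurable_funM => //; exact: measurable_funTS|
    by move=> t _; rewrite -!EFinM lee_fin mulr_ge0|
    by apply/measurable_EFinP; apply: measurable_funM => //; exact: measurable_funTS].
  rewrite !ge0_integralZl_EFin// ?Ss ?Sp//.
  - by move=> t _; rewrite lee_fin.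
  - exact: mE.
  - by move=> t _; rewrite lee_fin.
  - exact: mE.
(* The factor [M] is the length of [[M, 2M]], over which the bound [Fy] is integrated. The final
   integration over [[-M, M]], of length [2M], doubles the constants 2 and 24. *)
have FM t : M * F t <= 2 * p + 24 * M ^+ 2 * s.
  have [->|/Fsupp[tM htM]] := eqVneq (F t) 0.
    by rewrite mulr0 addr_ge0 ?mulr_ge0.
  have Fy y : M <= y <= M *+ 2 -> F t <= 2 * m y + 24 * M * s.
    move=> /andP[My yM].
    apply: (le_trans (Fh t)).
    have hmy := hm y My.
    (* No bound on [h y] is given, whereas [sqr_increment_le] asks for a bounded increment. If [h y]
       is at least as large as [h t] in absolute value, then [m y] already bounds [h t ^+ 2];
       otherwise [h y] inherits the bound [2M] of [h t]. *)
    have [hy|hy] := leP `|h t| `|h y|.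
      have : h t ^+ 2 <= h y ^+ 2 by rewrite -[leLHS]real_normK ?num_real// -[leRHS]real_normK ?num_real// lerXn2r ?nnegrE.
      have : 0 <= M * s by rewrite mulr_ge0// ltW.
      have := m0 y; lra.
    have : `|h y - h t| <= M *+ 4.
      by rewrite (le_trans (ler_normB _ _))//; lra.
    move: tM; rewrite ler_norml => tM.
    have My2 : M <= y <= M *+ 2 by rewrite My.
    move=> /(sqr_increment_le M h h' D t y M0 tM My2 hh ch' cD D0 hD).
    rewrite -/J Ss -EFinM lee_fin => H.
    (* This square is the difference of the two sides of
       [(h t)^2 <= 2 (h y)^2 + 2 (h y - h t)^2]. *)
    have : 0 <= (h t - h y *+ 2) ^+ 2 by rewrite sqr_ge0.
    rewrite !expr2 in H hmy *; lra.
  suff : ((M * F t)%:E <= (2 * p + 24 * M ^+ 2 * s)%:E)%E by rewrite lee_fin.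
  apply: (@le_trans _ _ (\int[lebesgue_measure]_(y in `[M, (M *+ 2)%R]) (F t)%:E)%E).
    rewrite integral_cst//= lebesgue_measure_itv/= lte_fin.
    have -> : M < M *+ 2 by lra.
    by rewrite -EFinB -EFinM lee_fin; lra.
  apply: (@le_trans _ _ (\int[lebesgue_measure]_(y in `[M, (M *+ 2)%R])
     ((2 * m y)%R%:E + (24 * M * s)%R%:E))%E).
    apply: ge0_le_integral => //.
    - by move=> y _; rewrite lee_fin.
    - by apply: emeasurable_funD => //; apply/measurable_EFinP; apply: measurable_funM => //; exact: measurable_funTS.
  rewrite ge0_integralD//=.
  - rewrite integral_cst//= lebesgue_measure_itv/= lte_fin.
    have -> : M < M *+ 2 by lra.
    rewrite [leRHS]EFinD; apply: leeD; last by rewrite -EFinB -EFinM lee_fin; lra.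
    rewrite EFinM -Sp -ge0_integralZl_EFin//; [|by move=> ? _; rewrite lee_fin|exact: mE].
    apply: ge0_subset_integral => //.
    - by apply/measurable_EFinP; apply: measurable_funM => //; exact: measurable_funTS.
    - by move=> y _; rewrite lee_fin mulr_ge0.
    - by move=> y /=; rewrite /J/= !in_itv/= => /andP[? ?]; apply/andP; split; lra.
  - by move=> y _; rewrite lee_fin mulr_ge0.
  - by apply/measurable_EFinP; apply: measurable_funM => //; exact: measurable_funTS.
  - by move=> y _; rewrite lee_fin !mulr_ge0// ltW.
have -> : (\int[lebesgue_measure]_t (F t)%:E =
    \int[lebesgue_measure]_(t in `[(- M)%R, M]) (F t)%:E)%E.
  rewrite [RHS]integral_mkcond; apply: eq_integral => t _; rewrite patchE.
  case: ifPn => // tM; congr EFin; apply/eqP; apply: contraNT tM => /Fsupp[tM _].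
  by rewrite inE/= in_itv/= -ler_norml.
apply: (@le_trans _ _ (\int[lebesgue_measure]_(t in `[(- M)%R, M])
    ((2 * p + 24 * M ^+ 2 * s) / M)%R%:E)%E).
  apply: ge0_le_integral => //.
  - by move=> t _; rewrite lee_fin.
  - by apply/measurable_EFinP; exact: measurable_funTS.
  - by move=> t _; rewrite lee_fin ler_pdivlMr// mulrC.
rewrite integral_cst//= lebesgue_measure_itv/= lte_fin.
have -> : - M < M by lra.
rewrite -EFinB -EFinM lee_fin opprK.
by rewrite (_ : _ * (M + M) = (2 * p + 24 * M ^+ 2 * s) *+ 2); [lra|field; lra].
Qed.

(** * The Euclidean norm *)

Lemma dotvv_ge0 {R : realType} {n} (u : 'rV[R]_n) : 0 <= dotv u u.
Proof. by rewrite dotvE sumr_ge0// => i _; rewrite -expr2 sqr_ge0. Qed.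

Lemma sqr_coord_le_dotvv {R : realType} {n} (u : 'rV[R]_n) i :
  u ord0 i ^+ 2 <= dotv u u.
Proof.
rewrite dotvE (bigD1 i)//= expr2 lerDl sumr_ge0// => j _.
by rewrite -expr2 sqr_ge0.
Qed.

Lemma dotvv_eq0 {R : realType} {n} (u : 'rV[R]_n) : dotv u u = 0 -> u = 0.
Proof.
move=> u0; apply/rowP => i; rewrite mxE; apply/eqP.
have := sqr_coord_le_dotvv u i; rewrite u0 => ui.
by rewrite -sqrf_eq0 eq_le ui sqr_ge0.
Qed.

(** Cauchy-Schwarz: for [v] nonzero, expand the squared length of [dotv v v *: u - dotv u v *: v]
    and divide by [dotv v v]. *)
Lemma sqr_dotv_le {R : realType} {n} (u v : 'rV[R]_n) :
  dotv u v ^+ 2 <= dotv u u * dotv v v.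
Proof.
have [v0|v0] := eqVneq (dotv v v) 0.
  by rewrite v0 (dotvv_eq0 _ v0) dotvC -(scale0r 0) dotvZl mul0r expr0n mulr0.
have vgt0 : 0 < dotv v v by rewrite lt_neqAle eq_sym v0 dotvv_ge0.
have := dotvv_ge0 (dotv v v *: u - dotv u v *: v).
rewrite dotvBl !dotvZl !(dotvC _ (_ - _)) !dotvBl !dotvZl (dotvC v u) => H.
by rewrite -(ler_pM2l vgt0); lra.
Qed.

Lemma enorm_ge0 {R : realType} {n} (u : 'rV[R]_n) : 0 <= enorm u.
Proof. exact: sqrtr_ge0. Qed.

Lemma sqr_enorm {R : realType} {n} (u : 'rV[R]_n) : enorm u ^+ 2 = dotv u u.
Proof. by rewrite sqr_sqrtr// dotvv_ge0. Qed.

Lemma enormZ {R : realType} {n} (k : R) (u : 'rV[R]_n) :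
  enorm (k *: u) = `|k| * enorm u.
Proof.
by rewrite /enorm dotvZl dotvC dotvZl mulrA -expr2 sqrtrM ?sqr_ge0// sqrtr_sqr.
Qed.

Lemma enormD {R : realType} {n} (u v : 'rV[R]_n) :
  enorm (u + v) <= enorm u + enorm v.
Proof.
have uv0 : 0 <= enorm u + enorm v by rewrite addr_ge0 ?enorm_ge0.
rewrite -(@ler_pXn2r _ 2)// ?nnegrE ?enorm_ge0// sqr_enorm.
rewrite dotvDl !(dotvC _ (u + v)) !dotvDl (dotvC v u) sqrrD !sqr_enorm.
have : dotv u v <= enorm u * enorm v.
  apply: (le_trans (ler_norm _)).
  rewrite -(@ler_pXn2r _ 2)// ?nnegrE ?mulr_ge0 ?enorm_ge0//.
  by rewrite real_normK ?num_real// exprMn !sqr_enorm sqr_dotv_le.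
lra.
Qed.

Lemma normr_coord_le_enorm {R : realType} {n} (u : 'rV[R]_n) i :
  `|u ord0 i| <= enorm u.
Proof.
rewrite -(@ler_pXn2r _ 2)// ?nnegrE ?enorm_ge0// real_normK ?num_real//.
by rewrite sqr_enorm sqr_coord_le_dotvv.
Qed.

(** * Coercivity of a monotone map away from a ball *)

Lemma is_derive_dotvl {R : realType} {n} (M : R -> 'rV[R]_n) (dM h : 'rV[R]_n)
  (t : R) : is_derive t 1 M dM ->
  is_derive t 1 (fun s => dotv (M s) h) (dotv dM h).
Proof.
move=> hM.
have dMt : derivable M t 1 by exact: ex_derive.
have dMi i : is_derive t 1 (fun s => M s ord0 i * h ord0 i) (dM ord0 i * h ord0 i).
  have : is_derive t 1 (fun s => M s ord0 i) (dM ord0 i).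
    apply: DeriveDef; first by move/derivable_mxP : dMt; apply.
    by rewrite -(@derive_val _ _ _ _ _ _ _ hM) derive_mx// mxE.
  move=> H; apply: is_derive_eq.
  by rewrite /GRing.scale/=; ring.
have := @is_derive_sum _ _ _ _ _ _ _ _ dMi.
rewrite -dotvE (_ : \sum_i _ = fun s => dotv (M s) h)//.
by apply/funext => s; rewrite fct_sumE dotvE.
Qed.

(* If the segment [x, y] met the ball of radius [r] both in its first and in
   its last quarter, both [x] and [y] would be in the ball of radius [2r]. *)
Lemma segment_quarter_outside {R : realType} {n} (x y : 'rV[R]_n) (r : R) :
  r *+ 2 <= enorm x \/ r *+ 2 <= enorm y ->
  (forall t, 0 <= t <= 4^-1 -> r <= enorm (t *: (y - x) + x)) \/
  (forall t, 3 / 4 <= t <= 1 -> r <= enorm (t *: (y - x) + x)).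
Proof.
move=> xy; apply: contrapT => /not_orP[].
move=> /existsNP[t /not_implyP[/andP[t0 t4] /negP]]; rewrite -ltNge => pr.
move=> /existsNP[s /not_implyP[/andP[s3 s1] /negP]]; rewrite -ltNge => qr.
set p := t *: (y - x) + x in pr; set q := s *: (y - x) + x in qr.
have st : 0 < s - t by lra.
have qp : y - x = (s - t)^-1 *: (q - p).
  rewrite /p /q opprD addrACA subrr addr0 -scalerBl scalerA mulVf ?scale1r//.
  exact: lt0r_neq0.
(* Since [t] and [1 - s] are at most 1/4 and [s - t] is at least 1/2, the endpoints [x] and [y] are
   reached from [p] and [q] by adding at most half of [q - p] in length, that is, less than [r]. *)
have close k : `|k| <= 2^-1 -> enorm (p + k *: (q - p)) < r *+ 2.
  move=> k2; apply: (le_lt_trans (enormD _ _)).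
  rewrite enormZ.
  have qp' : enorm (q - p) <= enorm q + enorm p.
    by apply: (le_trans (enormD _ _)); rewrite -scaleN1r enormZ normrN1 mul1r.
  have := enorm_ge0 (q - p); have := enorm_ge0 p; have := normr_ge0 k; nra.
have close' k : `|k| <= 2^-1 -> enorm (q + k *: (q - p)) < r *+ 2.
  move=> k2; apply: (le_lt_trans (enormD _ _)).
  rewrite enormZ.
  have qp' : enorm (q - p) <= enorm q + enorm p.
    by apply: (le_trans (enormD _ _)); rewrite -scaleN1r enormZ normrN1 mul1r.
  have := enorm_ge0 (q - p); have := enorm_ge0 p; have := normr_ge0 k; nra.
have xE : x = p + (- (t / (s - t))) *: (q - p).
  by rewrite scaleNr -scalerA -qp /p addrAC subrr add0r.
have yE : y = q + ((1 - s) / (s - t)) *: (q - p).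
  by rewrite -scalerA -qp /q addrAC -scalerDl (addrC s) subrK scale1r subrK.
case: xy; rewrite leNgt => /negP; apply.
  rewrite xE; apply: close; rewrite normrN ger0_norm ?divr_ge0 ?(ltW st)//.
  by rewrite ler_pdivrMr//; lra.
rewrite yE; apply: close'; rewrite ger0_norm ?divr_ge0 ?(ltW st)//; last by lra.
by rewrite ler_pdivrMr//; lra.
Qed.

(** By monotonicity, [G t = A (x + t h) . h] is nondecreasing, and on a quarter of [[0, 1]] the
    segment is outside the ball, where the derivative of [G] is at least [K |h|^2]. Hence
    [G 1 - G 0 >= K |h|^2 / 4]. *)
Lemma monotone_coercive {R : realType} {n} (A : 'rV[R]_n -> 'rV[R]_n)
    (r K : R) (x y : 'rV[R]_n) :
  0 < K -> (forall x, differentiable A x) -> monotone_map A ->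
  (forall x, r <= enorm x -> mx_form_le K%:M (sym_jacobian A x)) ->
  r *+ 2 <= enorm x \/ r *+ 2 <= enorm y ->
  dotv (y - x) (y - x) <= 4 / K * dotv (A y - A x) (y - x).
Proof.
move=> K0 dA mA AK xy; set h := y - x.
pose G (t : R) := dotv (A (t *: h + x)) h.
pose dG (t : R) := dotv ('D_h A (t *: h + x)) h.
have hG (t : R) : is_derive t 1 G (dG t).
  by apply: is_derive_dotvl; apply: is_derive_line; exact: diff_derivable.
have Gmono s t : s <= t -> G s <= G t.
  rewrite le_eqVlt => /predU1P[->//|st].
  have := mA (t *: h + x) (s *: h + x).
  rewrite opprD addrACA subrr addr0 -scalerBl dotvC dotvZl pmulr_rge0 ?subr_gt0//.
  by rewrite dotvC dotvBl subr_ge0.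
have dG_ge t : r <= enorm (t *: h + x) -> K * dotv h h <= dG t.
  move=> /AK/(_ h); rewrite mul_mx_scalar dotvZl => /le_trans; apply.
  rewrite /sym_jacobian -scalemxAr dotvZl mulmxDr dotvDl /dG deriveEjacobian//.
  set J := jacobian _ _.
  have -> : dotv (h *m J^T) h = dotv (h *m J) h.
    by rewrite dotvC /dotv trmx_mul trmxK mulmxA.
  lra.
have cG s t : {within `[s, t], continuous G}.
  by apply: derivable_within_continuous => u _; exact: ex_derive.
have mv s t : s < t -> (forall u, s <= u <= t -> r <= enorm (u *: h + x)) ->
    (t - s) * (K * dotv h h) <= G t - G s.
  move=> st hu.
  have [u] := MVT st (fun u _ => hG u) (cG s t).
  rewrite in_itv/= => /andP[su ut] ->; rewrite mulrC ler_pM2r ?subr_gt0//.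
  by apply: dG_ge; apply: hu; rewrite !ltW.
have -> : dotv (A y - A x) h = G 1 - G 0.
  by rewrite dotvBl /G scale1r scale0r add0r /h subrK.
suff : K * dotv h h <= 4 * (G 1 - G 0).
  by rewrite mulrAC ler_pdivlMr// mulrC.
have := Gmono 0 4^-1; have := Gmono (3 / 4) 1; have := Gmono 4^-1 (3/4).
have [a b c] : [/\ 4^-1 <= 3 / 4 :> R, 3 / 4 <= 1 :> R & 0 <= 4^-1 :> R] by split; lra.
move=> /(_ a) Ga /(_ b) Gb /(_ c) Gc.
case: (segment_quarter_outside _ _ _ xy) => H.
  have : 0 < 4^-1 :> R by lra.
  by move=> /mv /(_ H); lra.
have : 3 / 4 < 1 :> R by lra.
by move=> /mv /(_ H); lra.
Qed.

(** * Integration along coordinate lines and against a density *)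

Lemma ge0_integral_lebesgue_rVS {R : realType} {n} (F : 'rV[R]_n.+1 -> \bar R) :
  measurable_fun setT F -> (forall x, 0 <= F x)%E ->
  (\int[lebesgue_rV n.+1]_x F x =
   \int[@lebesgue_measure R \x lebesgue_rV n]_z F (rV_cons z))%E.
Proof.
move=> mF F0.
have := @ge0_integral_pushforward _ _ _ _ R _ (@measurable_rV_cons R n)
  (@lebesgue_measure R \x lebesgue_rV n)%E setT F measurableT mF (fun x _ => F0 x).
by rewrite preimage_setT.
Qed.

(** A line parallel to the [i]-th axis is represented by its point with [i]-th coordinate 0. By
    induction on [n] with Tonelli: the first coordinate is frozen in the outer integral when it is
    not the [i]-th one, and is the inner variable when it is. *)
Lemma le_integral_lines {R : realType} {n} (i : 'I_n) (F G : 'rV[R]_n -> \bar R) :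
  measurable_fun setT F -> (forall x, 0 <= F x)%E ->
  measurable_fun setT G -> (forall x, 0 <= G x)%E ->
  (forall x : 'rV[R]_n, x ord0 i = 0 ->
    (\int[lebesgue_measure]_t F ((t : R) *: delta_mx 0 i + x)%R <=
     \int[lebesgue_measure]_t G ((t : R) *: delta_mx 0 i + x)%R)%E) ->
  (\int[lebesgue_rV n]_x F x <= \int[lebesgue_rV n]_x G x)%E.
Proof.
elim: n i F G => [[]//|n IH] i F G mF F0 mG G0 FG.
have mFc : measurable_fun setT (F \o @rV_cons R n).
  by apply: measurableT_comp => //; exact: measurable_rV_cons.
have mGc : measurable_fun setT (G \o @rV_cons R n).
  by apply: measurableT_comp => //; exact: measurable_rV_cons.
rewrite !ge0_integral_lebesgue_rVS//.
have [j ij|i0] := unliftP ord0 i.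
  rewrite (fubini_tonelli1 (F \o @rV_cons R n))//; last by move=> z; exact: F0.
  rewrite (fubini_tonelli1 (G \o @rV_cons R n))//; last by move=> z; exact: G0.
  apply: ge0_le_integral => //.
  - by move=> s _; apply: integral_ge0 => v _; exact: F0.
  - by apply: measurable_fun_fubini_tonelli_F => // z; exact: F0.
  - by apply: measurable_fun_fubini_tonelli_F => // z; exact: G0.
  move=> s _; apply: (IH j) => //.
  - by apply: measurableT_comp => //; exact: measurable_pair1.
  - by move=> v; exact: F0.
  - by apply: measurableT_comp => //; exact: measurable_pair1.
  - by move=> v; exact: G0.
  move=> v vj /=.
  have E (t : R) : rV_cons (s, (t *: delta_mx 0 j + v)%R) = (t *: delta_mx 0 i + rV_cons (s, v))%R.
    apply/rowP => k; rewrite !mxE; case: unliftP => [k' ->|->]/=.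
      by rewrite !mxE ij (inj_eq lift_inj).
    by rewrite ij (negbTE (neq_lift _ _)) mulr0 add0r.
  under eq_integral do rewrite E.
  under [X in (_ <= X)%E]eq_integral do rewrite E.
  by apply: FG; rewrite mxE ij liftK.
rewrite (fubini_tonelli2 (F \o @rV_cons R n))//; last by move=> z; exact: F0.
rewrite (fubini_tonelli2 (G \o @rV_cons R n))//; last by move=> z; exact: G0.
apply: ge0_le_integral => //.
- by move=> s _; apply: integral_ge0 => v _; exact: F0.
- by apply: measurable_fun_fubini_tonelli_G => // z; exact: F0.
- by apply: measurable_fun_fubini_tonelli_G => // z; exact: G0.
move=> v _ /=; rewrite /fubini_G/=.
have E (t : R) : rV_cons (t, v) = (t *: delta_mx 0 i + rV_cons (0, v))%R.
  apply/rowP => k; rewrite !mxE i0; case: unliftP => [k' ->|->]/=.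
    by rewrite mulr0 add0r.
  by rewrite mulr1 addr0.
under eq_integral do rewrite E.
under [X in (_ <= X)%E]eq_integral do rewrite E.
by apply: FG; rewrite mxE i0 unlift_none.
Qed.

(** The hypothesis [has_density] only speaks of measures of sets. It makes the Radon-Nikodym
    derivative of [nu] equal to [f] almost everywhere, and the change of variables for that
    derivative concludes. *)
Lemma ge0_integral_density {R : realType} {n} (nu : probability 'rV[R]_n R)
    (f : 'rV[R]_n -> R) (g : 'rV[R]_n -> \bar R) :
  measurable_fun setT f -> has_density nu f ->
  measurable_fun setT g -> (forall x, 0 <= g x)%E ->
  (\int[nu]_x g x = \int[lebesgue_rV n]_x (g x * (f x)%:E))%E.
Proof.
move=> mf nuf mg g0.
have dom : nu `<< lebesgue_rV n.
  apply/null_content_dominatesP => A mA A0.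
  rewrite nuf//; apply: null_set_integral => //.
  exact/measurable_EFinP/measurable_funTS.
rewrite -(Radon_Nikodym_SigmaFinite.change_of_variables dom g0)//.
have mfE : measurable_fun setT (EFin \o f) by exact/measurable_EFinP.
have intf := Radon_Nikodym_SigmaFinite.f_integrable dom.
have mRN := measurable_int _ intf.
apply: ae_eq_integral => //.
- exact: emeasurable_funM.
- exact: emeasurable_funM.
have : ae_eq (lebesgue_rV n) setT
    (Radon_Nikodym_SigmaFinite.f nu (lebesgue_rV n)) (EFin \o f).
  apply: integral_ae_eq => // A _ mA.
  by rewrite -Radon_Nikodym_SigmaFinite.f_integral//; exact: nuf.
by apply: filterS => x /= E _; rewrite E.
Qed.

(** * Continuity and measurability on R^n *)

Lemma measurable_fun_continuous_rV {R : realType} {n} (f : 'rV[R]_n -> R) :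
  continuous f -> measurable_fun setT f.
Proof.
move=> cf; apply: (measurability _ (RGenOpens.measurableE R)).
move=> _ [_ [a [b ->] <-]]; rewrite setTI; apply: sub_sigma_algebra.
by apply: open_comp (interval_open _ _) => // x _; exact: cf.
Qed.

Lemma continuous_coord {R : realType} {n} {T : topologicalType}
    (f : T -> 'rV[R]_n) i : continuous f -> continuous (fun x => f x ord0 i).
Proof.
move=> cf x; apply: (@continuous_comp _ _ _ f (fun v : 'rV[R]_n => v ord0 i)).
  exact: cf.
exact: coord_continuous.
Qed.

Lemma continuous_sumr {R : realType} {n} {T : topologicalType}
    (f : 'I_n -> T -> R) : (forall i, continuous (f i)) ->
  continuous (fun x => \sum_i f i x).
Proof.
move=> cf x; apply: cvg_big => [|i _]; [exact: add_continuous|exact: cf].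
Qed.

Lemma continuous_dotv {R : realType} {n} {T : topologicalType}
    (f g : T -> 'rV[R]_n) : continuous f -> continuous g ->
  continuous (fun x => dotv (f x) (g x)).
Proof.
move=> cf cg.
have -> : (fun x => dotv (f x) (g x)) =
    fun x => \sum_i f x ord0 i * g x ord0 i.
  by apply/funext => x; rewrite dotvE.
apply: continuous_sumr => i x.
by apply: cvgM; exact: continuous_coord.
Qed.

Lemma C1_continuous {R : realType} {n} {W : normedModType R}
  (f : 'rV[R]_n -> W) : C1 f -> continuous f.
Proof. by move=> [df _] x; exact: differentiable_continuous. Qed.

Lemma continuous_derive_grad {R : realType} {n} (f : 'rV[R]_n -> R)
    (i : 'I_n) : C1 (grad f) -> continuous (fun x =>
    'D_(delta_mx 0 i) (fun y => 'D_(delta_mx 0 i) f y) x).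
Proof.
move=> Cg; have [_ /(_ (delta_mx 0 i)) cDg] := Cg.
rewrite (_ : (fun x => _) = fun x => 'D_(delta_mx 0 i) (grad f) x ord0 i).
  exact: continuous_coord.
by apply/funext => x; exact: derive_gradE.
Qed.

(** * Coupling given by a map, and bounds on the density over a cube *)

(** The law of [(x, T x)] under [nu] is a coupling, hence a competitor in the infimum. *)
Lemma W2_pushforward_le {R : realType} {n} (nu mu : probability 'rV[R]_n R)
    (T : 'rV[R]_n -> 'rV[R]_n) : continuous T ->
  (forall B, measurable B -> pushforward nu T B = mu B) ->
  (W2 nu mu <= sqrte (\int[nu]_x (dotv (T x - x) (T x - x))%:E))%E.
Proof.
move=> cT numu.
have mT : measurable_fun setT T.
  apply: measurable_fun_rV => i; apply: measurable_fun_continuous_rV.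
  exact: continuous_coord.
have mG : measurable_fun setT (fun x : 'rV[R]_n => (x, T x)).
  by apply/measurable_fun_pairP; split; [exact: measurable_id|exact: mT].
pose G : {mfun _ >-> _} := HB.pack (fun x : 'rV[R]_n => (x, T x))
  (isMeasurableFun.Build _ _ _ _ _ mG).
rewrite lee_sqrt; last first.
  by apply: integral_ge0 => x _; rewrite lee_fin dotvv_ge0.
apply: ereal_inf_lbound => /=.
exists (distribution nu G).
  move=> B mB; split => //.
  by rewrite -numu.
rewrite ge0_integral_pushforward//.
- rewrite preimage_setT; apply: eq_integral => x _ /=; congr EFin.
  by rewrite -opprB -scaleN1r dotvZl dotvC dotvZl; ring.
- apply/measurable_EFinP.
  under eq_fun do rewrite dotvE.
  apply: measurable_sum => i; apply: measurable_funM;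
  (under eq_fun do rewrite !mxE; apply: measurable_funB;
   apply: (measurableT_comp (measurable_coord_rV i)) => //).
- by move=> z _; rewrite lee_fin dotvv_ge0.
Qed.

(** Extreme values of [V] on a compact cube. The final constant depends on [V] only through these
    two bounds. *)
Lemma box_expR_bounds {R : realType} {n} (V : 'rV[R]_n -> R) (L : R) :
  0 <= L -> continuous V ->
  exists ab : R * R, [/\ 0 < ab.1, 0 < ab.2 &
    forall x : 'rV[R]_n, (forall i, `|x ord0 i| <= L) -> ab.1 <= expR (- V x) <= ab.2].
Proof.
move=> L0 cV.
pose B : set 'rV[R]_n := [set x | forall i, `[- L, L]%classic (x ord0 i)].
have cB : compact B.
  by apply: (rV_compact (A := fun=> `[- L, L]%classic)) => i; exact: segment_compact.
have B0 : B !=set0.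
  by exists 0 => i; rewrite mxE /= in_itv/= L0 oppr_le0 L0.
have BP (x : 'rV[R]_n) : (forall i, `|x ord0 i| <= L) -> x \in B.
  by move=> xL; rewrite inE => i /=; rewrite in_itv/= -ler_norml.
have [p _ Vp] := EVT_min_rV B0 cB (continuous_subspaceT cV).
have [q _ Vq] := EVT_max_rV B0 cB (continuous_subspaceT cV).
exists (expR (- V q), expR (- V p)); split; rewrite ?expR_gt0// => x /BP xB.
by rewrite !ler_expR !lerN2 Vp// Vq.
Qed.

(** * Sign and continuity of the two parts of the integrand of J *)

(* The diagonal entries of [D^2 phi + (D^2 phi)^-1 - 2 Id]. *)
Definition hessian_defect {R : realType} {n} (phi : 'rV[R]_n -> R) (i : 'I_n)
    (x : 'rV[R]_n) : R :=
  'D_(delta_mx 0 i) (fun y => 'D_(delta_mx 0 i) phi y) x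
  + 'D_(delta_mx 0 i) (fun y => 'D_(delta_mx 0 i) (conjugateR phi) y)
      (grad phi x) - 2.

Lemma J_integrandE {R : realType} {n} (A : 'rV[R]_n -> 'rV[R]_n)
    (phi : 'rV[R]_n -> R) (x : 'rV[R]_n) :
  J_integrand A phi x = \sum_i hessian_defect phi i x +
    dotv (A (grad phi x) - A x) (grad phi x - x).
Proof.
rewrite /J_integrand /laplacian /hessian_defect !big_split/=.
by rewrite sumr_const card_ord mulNrn mulr_natr.
Qed.

Section displacement.
Context {R : realType} {n : nat} {A : 'rV[R]_n -> 'rV[R]_n}.
Context {phi : 'rV[R]_n -> R}.
Context (C1A : C1 A) (mA : monotone_map A) (phireg : caffarelli_regular phi).

Let drift (x : 'rV[R]_n) : R := dotv (A (grad phi x) - A x) (grad phi x - x).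

(** This is [conjugate_curvature] with [c = 1 - d]; the case [d = 0] is nonnegativity. *)
Lemma hessian_defect_ge i x d :
  d * (2 - d) * ('D_(delta_mx 0 i) (fun y => 'D_(delta_mx 0 i) phi y) x - 1)
  <= hessian_defect phi i x + d ^+ 2.
Proof.
have gen (p p' : R) : (1 - d) *+ 2 - (1 - d) ^+ 2 * p <= p' ->
    d * (2 - d) * (p - 1) <= p + p' - 2 + d ^+ 2 by lra.
exact/gen/conjugate_curvature.
Qed.

Lemma hessian_defect_ge0 i x : 0 <= hessian_defect phi i x.
Proof. by have := hessian_defect_ge i x 0; rewrite expr0n/= !mul0r addr0. Qed.

Lemma drift_ge0 x : 0 <= drift x.
Proof. exact: mA. Qed.

Lemma continuous_grad_potential : continuous (grad phi).
Proof. by case: phireg => -[_ /C1_continuous]. Qed.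

Lemma continuous_hessian_defect i : continuous (hessian_defect phi i).
Proof.
case: phireg => -[_ Cg] _ _ [_ Cgs] _ x.
have hs : {for x, continuous (fun x =>
    'D_(delta_mx 0 i) (fun y => 'D_(delta_mx 0 i) (conjugateR phi) y) (grad phi x))}.
  apply: (@continuous_comp _ _ _ (grad phi)
    (fun z => 'D_(delta_mx 0 i) (fun y => 'D_(delta_mx 0 i) (conjugateR phi) y) z)).
    exact: continuous_grad_potential.
  exact: continuous_derive_grad.
exact: (cvgB (cvgD (continuous_derive_grad _ i Cg x) hs) (cvg_cst _)).
Qed.

Lemma continuous_drift : continuous drift.
Proof.
have cg := continuous_grad_potential; have cA := C1_continuous _ C1A.
apply: continuous_dotv => x; last exact: (cvgB (cg x) cvg_id).
have cAg : {for x, continuous (A \o grad phi)}.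
  by apply: continuous_comp; [exact: cg|exact: cA].
exact: (cvgB cAg (cA x)).
Qed.

Lemma drift_le_J_integrand x : drift x <= J_integrand A phi x.
Proof.
rewrite J_integrandE lerDr sumr_ge0// => j _; exact: hessian_defect_ge0.
Qed.

Lemma hessian_defect_le_J_integrand i x :
  hessian_defect phi i x + drift x <= J_integrand A phi x.
Proof.
rewrite J_integrandE lerD2r (bigD1 i)//= lerDl sumr_ge0// => j _.
exact: hessian_defect_ge0.
Qed.

Lemma J_integrand_ge0 x : 0 <= J_integrand A phi x.
Proof.
rewrite J_integrandE addr_ge0 ?drift_ge0// sumr_ge0// => j _.
exact: hessian_defect_ge0.
Qed.

Lemma continuous_J_integrand : continuous (J_integrand A phi).
Proof.
have -> : J_integrand A phi = fun x => \sum_i hessian_defect phi i x + drift x.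
  by apply/funext => x; exact: J_integrandE.
move=> x; have csum : {for x, continuous (fun x => \sum_i hessian_defect phi i x)}.
  by apply: continuous_sumr => i; exact: continuous_hessian_defect.
exact: (cvgD csum (continuous_drift x)).
Qed.

End displacement.

(** * The excess of the squared displacement along coordinate lines *)

Section coordinate.
Context {R : realType} {n : nat} {A : 'rV[R]_n -> 'rV[R]_n}.
Context {phi : 'rV[R]_n -> R} {r K : R}.
Context (C1A : C1 A) (mA : monotone_map A) (phireg : caffarelli_regular phi).
Context (r0 : 0 <= r) (K0 : 0 < K).
Context (AK : forall x, r <= enorm x -> mx_form_le K%:M (sym_jacobian A x)).

Let drift (x : 'rV[R]_n) : R := dotv (A (grad phi x) - A x) (grad phi x - x).
Let h i x : R := (grad phi x - x) ord0 i.

(* The part of the squared displacement that the drift does not control. It is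
   continuous, and vanishes unless both [x] and its image are in the ball of
   radius [2r]. *)
Definition excess (i : 'I_n) (x : 'rV[R]_n) : R :=
  Num.max 0 (h i x ^+ 2 - 4 / K * drift x).

Lemma sqr_displacement_le_drift i x :
  r *+ 2 <= enorm x \/ r *+ 2 <= enorm (grad phi x) ->
  h i x ^+ 2 <= 4 / K * drift x.
Proof.
have [dA _] := C1A.
by move=> /(monotone_coercive _ _ _ _ _ K0 dA mA AK); apply: le_trans; exact: sqr_coord_le_dotvv.
Qed.

Lemma excess_neq0 i x : excess i x != 0 ->
  enorm x < r *+ 2 /\ enorm (grad phi x) < r *+ 2.
Proof.
move=> e0; have H : ~ (r *+ 2 <= enorm x \/ r *+ 2 <= enorm (grad phi x)).
  move=> /(sqr_displacement_le_drift i) le; move/eqP: e0; apply.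
  by rewrite /excess; apply/max_idPl; rewrite subr_le0.
by split; rewrite ltNge; apply/negP => ?; apply: H; [left|right].
Qed.

Lemma continuous_displacement i : continuous (h i).
Proof.
have cg : continuous (fun x => grad phi x - x).
  move=> x; exact: (cvgB (continuous_grad_potential phireg x) cvg_id).
exact: continuous_coord.
Qed.

Lemma measurable_excess i : measurable_fun setT (excess i).
Proof.
apply: measurable_maxr => //; apply: measurable_funB.
  by apply: measurable_funX; apply: measurable_fun_continuous_rV; exact: continuous_displacement.
apply: measurable_funM => //; apply: measurable_fun_continuous_rV.
exact: continuous_drift.
Qed.

Lemma continuous_line (x v : 'rV[R]_n) : continuous (fun t : R => t *: v + x).
Proof. by move=> t; apply: cvgD; [apply: cvgZl; exact: cvg_id|exact: cvg_cst]. Qed.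

(** An instance of [integral_line_le]: [h] is the [i]-th displacement, [h'] is [a - 1], [D] is the
    Hessian defect and [m] is [4 / K] times the drift. With [M = 2r + 1], positive even if [r = 0],
    points with [t >= M] are outside the ball of radius [2r], and the displacement is at most
    [4r <= 2M] where the excess is nonzero. *)
Lemma integral_excess_line_le i (x : 'rV[R]_n) (M : R) :
  M = r *+ 2 + 1 -> x ord0 i = 0 ->
  (\int[lebesgue_measure]_t (excess i (t *: delta_mx 0 i + x)%R)%:E <=
   \int[lebesgue_measure]_(t in `[(- (M *+ 2))%R, (M *+ 2)%R])
     ((16 / K + 48 * M ^+ 2) * J_integrand A phi (t *: delta_mx 0 i + x))%R%:E)%E.
Proof.
move=> ME xi0.
have M0 : 0 < M by rewrite ME ltr_wpDl ?mulrn_wge0.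
have K4 : 0 < 4 / K by rewrite divr_gt0.
pose l (t : R) := t *: delta_mx 0 i + x.
have li t : l t ord0 i = t by rewrite !mxE !eqxx xi0 addr0 mulr1.
have cl : continuous l by exact: continuous_line.
have ccomp (f : 'rV[R]_n -> R) : continuous f -> continuous (f \o l).
  by move=> cf t; apply: continuous_comp; [exact: cl|exact: cf].
pose a x := 'D_(delta_mx 0 i) (fun y => 'D_(delta_mx 0 i) phi y) x.
have [[_ Cg] _ _ _ _] := phireg.
have main := @integral_line_le R M (excess i \o l) (h i \o l)
  (fun t => a (l t) - 1) (hessian_defect phi i \o l)
  (fun t => 4 / K * drift (l t)) M0.
apply: (le_trans (main _ _ _ _ _ _ _ _ _ _ _ _)) => {main}.
- have := measurable_excess i; move=> /measurableT_comp; apply.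
  apply: measurable_fun_rV => j; apply: continuous_measurable_fun.
  exact: continuous_coord.
- by move=> t /=; rewrite /excess le_max lexx.
- move=> t /=; rewrite /excess ge_max sqr_ge0/= gerBl.
  by rewrite mulr_ge0 ?(ltW K4)// drift_ge0.
- move=> t /= /excess_neq0[lt glt].
  have := normr_coord_le_enorm (l t) i; have := normr_coord_le_enorm (grad phi (l t)) i.
  rewrite li => H1 H2; split; first by rewrite ME; lra.
  have -> : h i (l t) = grad phi (l t) ord0 i - t by rewrite /h [LHS]mxE [X in _ + X]mxE li.
  by rewrite (le_trans (ler_normB _ _))// ME; lra.
- move=> t; have -> : h i \o l = fun t => 'D_(delta_mx 0 i) phi (t *: delta_mx 0 i + x) - t.
    by apply/funext => s; rewrite /= /h [LHS]mxE [X in _ + X]mxE li mxE.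
  have := is_derive_line (fun y => 'D_(delta_mx 0 i) phi y) x (delta_mx 0 i) t
    (derivable_grad _ _ _ _ Cg).
  by move=> H; apply: is_derive_eq.
- move=> t; apply: (cvgB _ (cvg_cst _)); apply: (ccomp a).
  exact: continuous_derive_grad.
- by apply: ccomp; exact: continuous_hessian_defect.
- by move=> t; exact: hessian_defect_ge0.
- by move=> t d; exact: hessian_defect_ge.
- move=> t; apply: (cvgM (cvg_cst _)); apply: (ccomp drift).
  exact: continuous_drift.
- by move=> t; rewrite mulr_ge0 ?(ltW K4)// drift_ge0.
- move=> t Mt; apply: sqr_displacement_le_drift; left.
  have := normr_coord_le_enorm (l t) i; rewrite li.
  by have := ler_norm t; rewrite ME in Mt; lra.
have mJ : continuous (J_integrand A phi) by exact: continuous_J_integrand.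
have J0 := J_integrand_ge0 mA phireg.
have D0 := hessian_defect_ge0 phireg.
have d0 := drift_ge0 mA.
have cD : continuous (hessian_defect phi i) by exact: continuous_hessian_defect.
have cd : continuous drift by exact: continuous_drift.
have meas (f : 'rV[R]_n -> R) (B : set R) : continuous f ->
    measurable_fun B (fun t => f (l t)).
  by move=> cf; apply: measurable_funTS; apply: continuous_measurable_fun; exact: ccomp.
apply: ge0_le_integral => //.
- move=> t _; rewrite lee_fin addr_ge0// !mulr_ge0 ?(ltW K4) ?(ltW M0) ?d0 ?D0//.
  by rewrite invr_ge0 ltW.
- apply/measurable_EFinP; apply: measurable_funD.
    apply: measurable_funM => //; apply: measurable_funM => //; exact: (meas drift).
  by apply: measurable_funM => //; exact: (meas (hessian_defect phi i)).
- by apply/measurable_EFinP; apply: measurable_funM => //; exact: (meas (J_integrand A phi)).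
move=> t _; rewrite lee_fin -/(l t) [leRHS]mulrDl /=.
have -> : 4 * (4 / K * drift (l t)) = 16 / K * drift (l t) by field; exact: lt0r_neq0.
apply: lerD; first by rewrite ler_wpM2l ?divr_ge0 ?(ltW K0)//; exact: drift_le_J_integrand.
rewrite ler_wpM2l ?mulr_ge0 ?(ltW M0)//.
have := hessian_defect_le_J_integrand (A := A) phireg i (l t).
by have := d0 phi (l t); rewrite /drift /=; lra.
Qed.

End coordinate.

(** * Integration against nu *)

Section displacement_integral.
Context {R : realType} {n : nat} {A : 'rV[R]_n -> 'rV[R]_n}.
Context {phi : 'rV[R]_n -> R} {r K : R}.
Context (C1A : C1 A) (mA : monotone_map A) (phireg : caffarelli_regular phi).
Context (r0 : 0 <= r) (K0 : 0 < K).
Context (AK : forall x, r <= enorm x -> mx_form_le K%:M (sym_jacobian A x)).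
Context {V : 'rV[R]_n -> R} {nu : probability 'rV[R]_n R} {a b M : R}.
Context (cV : continuous V) (nuV : has_density nu (fun x => expR (- V x))).
Context (a0 : 0 < a) (b0 : 0 < b) (ME : M = r *+ 2 + 1).
Context (Vab : forall x : 'rV[R]_n, (forall i, `|x ord0 i| <= M *+ 2) ->
  a <= expR (- V x) <= b).

Let k := 16 / K + 48 * M ^+ 2.

(** Both sides become Lebesgue integrals weighted by [expR (- V x)] and are compared line by line.
    On the cube, the weight is bounded by [b] on the left and below by [a] on the right, whence the
    factor [b / a]. *)
Lemma integral_excess_le i :
  (\int[nu]_x (excess (A := A) (phi := phi) (K := K) i x)%:E <= (b / a * k)%:E * J nu A phi)%E.
Proof.
set e := excess i.
have M0 : 0 < M by rewrite ME ltr_wpDl ?mulrn_wge0.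
have k0 : 0 <= k.
  by rewrite addr_ge0 ?divr_ge0 ?mulr_ge0 ?(ltW K0) ?(ltW M0).
have := erefl (b / a * k); move: {1 3}(b / a * k) => c cE.
have c0 : 0 <= c by rewrite cE mulr_ge0 ?divr_ge0 ?(ltW a0) ?(ltW b0).
have e0 x : 0 <= e x by rewrite /e /excess le_max lexx.
have J0 x : 0 <= J_integrand A phi x by exact: J_integrand_ge0.
have cJ : continuous (J_integrand A phi) by exact: continuous_J_integrand.
have cw : continuous (fun x => expR (- V x)).
  move=> x; apply: (@continuous_comp _ _ _ (fun x => - V x) expR).
    exact: (cvgN (cV x)).
  exact: continuous_expR.
have mw := measurable_fun_continuous_rV _ cw.
have mJ := measurable_fun_continuous_rV _ cJ.
have me : measurable_fun setT e by exact: measurable_excess.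
rewrite /J (ge0_integral_density _ _ _ mw nuV); last 2 first.
- exact/measurable_EFinP.
- by move=> x; rewrite lee_fin.
rewrite (ge0_integral_density _ _ _ mw nuV); last 2 first.
- exact/measurable_EFinP.
- by move=> x; rewrite lee_fin.
rewrite -ge0_integralZl_EFin//; last 2 first.
- by move=> x _; rewrite -EFinM lee_fin mulr_ge0 ?expR_ge0.
- by apply/measurable_EFinP; exact: measurable_funM.
apply: (le_integral_lines i).
- by apply/measurable_EFinP; exact: measurable_funM.
- by move=> x; rewrite -EFinM lee_fin mulr_ge0 ?expR_ge0.
- apply/measurable_EFinP; apply: measurable_funM => //; exact: measurable_funM.
- by move=> x; rewrite -!EFinM lee_fin !mulr_ge0 ?expR_ge0.
move=> x xi0; pose l (t : R) := t *: delta_mx 0 i + x.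
have cl : continuous l by exact: continuous_line.
have li t : l t ord0 i = t by rewrite !mxE !eqxx xi0 addr0 mulr1.
have lj t j : j != i -> l t ord0 j = x ord0 j.
  by move=> ji; rewrite !mxE (negbTE ji) andbF mulr0 add0r.
have ml : measurable_fun setT l.
  apply: measurable_fun_rV => j; apply: continuous_measurable_fun.
  exact: continuous_coord.
have meas (f : 'rV[R]_n -> R) (B : set R) : measurable_fun setT f ->
    measurable_fun B (fun t => f (l t)).
  by move=> mf; apply: measurable_funTS; exact: (measurableT_comp mf ml).
(* If some coordinate of [x], necessarily not the [i]-th, exceeds [2M], the whole line avoids the
   ball of radius [2r] and the excess vanishes on it. *)
have [xM|xM] := pselect (forall j, `|x ord0 j| <= M *+ 2); last first.
  rewrite integral0_eq; last first.
    move=> t _; rewrite -/(l t).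
    suff -> : e (l t) = 0 by rewrite mul0e.
    apply: contra_notP xM => /eqP/(excess_neq0 C1A mA K0 AK)[lt _] j.
    have [->|/(lj t) <-] := eqVneq j i; first by rewrite xi0 normr0 mulrn_wge0// ltW.
    apply: (le_trans (normr_coord_le_enorm _ _)).
    by move: r0; rewrite ME; lra.
  by apply: integral_ge0 => t _; rewrite -!EFinM lee_fin !mulr_ge0 ?expR_ge0.
have lab t : `|t| <= M *+ 2 -> a <= expR (- V (l t)) <= b.
  by move=> tM; apply: Vab => j; have [->|/(lj t) ->] := eqVneq j i; rewrite ?li.
apply: (@le_trans _ _ (\int[lebesgue_measure]_t (b%:E * (e (l t))%:E))%E).
  apply: ge0_le_integral => //.
  - by move=> t _; rewrite -EFinM lee_fin mulr_ge0 ?expR_ge0.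
  - by apply/measurable_EFinP; apply: measurable_funM; [exact: (meas e)|exact: (meas _ _ mw)].
  - by apply/measurable_EFinP; apply: measurable_funM => //; exact: (meas e).
  move=> t _; rewrite -/(l t) -!EFinM lee_fin mulrC.
  have [->|/(excess_neq0 C1A mA K0 AK)[lt _]] := eqVneq (e (l t)) 0; first by rewrite !mulr0.
  rewrite ler_wpM2r//.
  have /lab/andP[] // : `|t| <= M *+ 2.
  rewrite -{1}(li t).
  apply: (le_trans (normr_coord_le_enorm _ _)).
  by move: r0; rewrite ME; lra.
rewrite ge0_integralZl_EFin//; last 3 first.
- by move=> t _; rewrite lee_fin.
- by apply/measurable_EFinP; exact: (meas e).
- exact: ltW.
have := integral_excess_line_le C1A mA phireg r0 K0 AK i x M ME xi0.
move=> /(lee_wpmul2l (x := b%:E)); rewrite lee_fin (ltW b0) => /(_ isT) H.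
apply: (le_trans H) => {H}.
have mB : measurable (`[(- (M *+ 2))%R, (M *+ 2)%R]%classic : set R) by exact: measurable_itv.
rewrite -ge0_integralZl_EFin//; last 3 first.
- by move=> t _; rewrite lee_fin mulr_ge0.
- by apply/measurable_EFinP; apply: measurable_funM => //; exact: (meas _ _ mJ).
- exact: ltW.
(* The lower bound [a] on the weight holds only for [|t| <= 2M], so the right-hand integral is first
   cut down to this segment. *)
apply: (@le_trans _ _ (\int[lebesgue_measure]_(t in `[(- (M *+ 2))%R, (M *+ 2)%R])
   (c%:E * ((J_integrand A phi (l t))%:E * (expR (- V (l t)))%:E)))%E); last first.
  apply: ge0_subset_integral => //.
  - apply/measurable_EFinP; apply: measurable_funM => //.
    by apply: measurable_funM; [exact: (meas _ _ mJ)|exact: (meas _ _ mw)].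
  - by move=> t _; rewrite -!EFinM lee_fin !mulr_ge0 ?expR_ge0.
apply: ge0_le_integral => //.
- by move=> t _; rewrite -EFinM lee_fin !mulr_ge0 ?(ltW b0).
- apply/measurable_EFinP; apply: measurable_funM => //; apply: measurable_funM => //.
  exact: (meas _ _ mJ).
- apply/measurable_EFinP; apply: measurable_funM => //.
  by apply: measurable_funM; [exact: (meas _ _ mJ)|exact: (meas _ _ mw)].
move=> t /=; rewrite in_itv/= -ler_norml => /lab/andP[aw _].
rewrite -/(l t) -/k -!EFinM lee_fin.
have -> : b * (k * J_integrand A phi (l t)) = c * (J_integrand A phi (l t) * a).
  by rewrite cE; field; exact: lt0r_neq0.
by rewrite ler_wpM2l// ler_wpM2l.
Qed.

(** Each squared coordinate of the displacement is at most [4 / K] times the drift plus its excess.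
    Integrating bounds it by the same multiple of J for every coordinate, and summing gives the
    factor [n]. *)
Lemma integral_displacement_le :
  (\int[nu]_x (dotv (grad phi x - x) (grad phi x - x))%:E <=
   (n%:R * (4 / K + b / a * k))%:E * J nu A phi)%E.
Proof.
have J0 x : 0 <= J_integrand A phi x by exact: J_integrand_ge0.
have mJ : measurable_fun setT (J_integrand A phi).
  by apply: measurable_fun_continuous_rV; exact: continuous_J_integrand.
have K4 : 0 <= 4 / K by rewrite divr_ge0// ltW.
have M0 : 0 < M by rewrite ME ltr_wpDl ?mulrn_wge0.
have k0 : 0 <= k.
  by rewrite addr_ge0 ?divr_ge0 ?mulr_ge0 ?(ltW K0) ?(ltW M0).
have c0 : 0 <= b / a * k by rewrite mulr_ge0 ?divr_ge0 ?(ltW a0) ?(ltW b0).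
under eq_integral do rewrite dotvE -sumEFin.
have mh i : measurable_fun setT (fun x => (grad phi x - x) ord0 i).
  by apply: measurable_fun_continuous_rV; exact: continuous_displacement.
rewrite ge0_integral_sum//; last 2 first.
- by move=> i; apply/measurable_EFinP; exact: measurable_funM.
- by move=> i x _; rewrite lee_fin -expr2 sqr_ge0.
have Jge0 : (0 <= J nu A phi)%E by apply: integral_ge0 => x _; rewrite lee_fin.
have bound i : (\int[nu]_x ((grad phi x - x) ord0 i * (grad phi x - x) ord0 i)%:E <=
    (4 / K + b / a * k)%:E * J nu A phi)%E.
  have me : measurable_fun setT (excess (A := A) (phi := phi) (K := K) i).
    exact: measurable_excess.
  have e0 x : 0 <= excess (A := A) (phi := phi) (K := K) i x.
    by rewrite /excess le_max lexx.
  rewrite EFinD ge0_muleDl ?lee_fin//.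
  apply: (le_trans _ (leeD (lexx _) (integral_excess_le i))).
  rewrite -ge0_integralZl_EFin//; last 2 first.
  - by move=> x _; rewrite lee_fin.
  - exact/measurable_EFinP.
  rewrite -ge0_integralD//; last 4 first.
  - by move=> x _; rewrite -EFinM lee_fin mulr_ge0.
  - by apply/measurable_EFinP; apply: measurable_funM.
  - by move=> x _; rewrite lee_fin.
  - exact/measurable_EFinP.
  apply: ge0_le_integral => //.
  - by move=> x _; rewrite lee_fin -expr2 sqr_ge0.
  - by apply/measurable_EFinP; exact: measurable_funM.
  - apply/measurable_EFinP; apply: measurable_funD => //; exact: measurable_funM.
  move=> x _; rewrite -EFinM -EFinD lee_fin -expr2.
  have : (grad phi x - x) ord0 i ^+ 2 - 4 / K * dotv (A (grad phi x) - A x) (grad phi x - x)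
     <= excess (A := A) (phi := phi) (K := K) i x by rewrite /excess le_max lexx orbT.
  have := ler_wpM2l K4 (drift_le_J_integrand (A := A) phireg x).
  lra.
apply: (le_trans (lee_sum _ (fun i _ => bound i))).
rewrite -ge0_sume_distrl; last by move=> i _; rewrite lee_fin addr_ge0.
by rewrite sumEFin sumr_const card_ord -[(_ + _) *+ n]mulr_natl lexx.
Qed.

End displacement_integral.

(** * A constant uniform in [A] *)

Theorem proposition3p4 (R : realType) (n : nat) (V : 'rV[R]_n -> R)
    (nu : probability 'rV[R]_n R) (r K : R) :
  C1 V ->
  has_density nu (fun x => expR (- V x)) ->
  finite_second_moment nu ->
  0 <= r -> 0 < K ->
  exists C : R, 0 < C /\
    forall A : 'rV[R]_n -> 'rV[R]_n,
      C1 A -> monotone_map A ->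
      (forall x, r <= enorm x -> mx_form_le K%:M (sym_jacobian A x)) ->
      WJ nu A C.
Proof.
move=> C1V nuV _ r0 K0.
have cV := C1_continuous _ C1V.
pose M := r *+ 2 + 1.
have M0 : 0 < M by rewrite ltr_wpDl ?mulrn_wge0.
(* The cube has half side [2M] so as to contain the segments [|t| <= 2M] on which the line estimate
   is integrated. *)
have [|[a b]/= [a0 b0 Vab]] := box_expR_bounds V (M *+ 2) _ cV.
  by rewrite mulrn_wge0// ltW.
pose c := 4 / K + b / a * (16 / K + 48 * M ^+ 2).
have c0 : 0 < c.
  rewrite ltr_pwDl ?divr_gt0// mulr_ge0 ?divr_ge0 ?(ltW a0) ?(ltW b0)//.
  by rewrite addr_ge0 ?divr_ge0 ?mulr_ge0 ?(ltW K0) ?(ltW M0).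
(* Using [n.+1] instead of [n] keeps the constant positive in dimension 0. *)
exists (n.+1%:R * c)^-1; split; first by rewrite invr_gt0 mulr_gt0.
move=> A C1A mA AK mu phi _ [_ _ numu] phireg.
have J0 x : 0 <= J_integrand A phi x by exact: J_integrand_ge0.
have Jge0 : (0 <= J nu A phi)%E by apply: integral_ge0 => x _; rewrite lee_fin.
split => //.
  split.
    apply/measurable_EFinP; apply: measurable_fun_continuous_rV.
    exact: continuous_J_integrand.
  (* The integrand is nonnegative, so its negative part vanishes; the integral itself may be
     infinite. *)
  right; rewrite integral0_eq ?ltry// => x _.
  by rewrite (@ge0_funenegE _ _ setT) ?inE// => y _; rewrite lee_fin.
apply: (le_trans (W2_pushforward_le _ _ _ (continuous_grad_potential phireg) numu)).
rewrite invrK lee_sqrt; last by rewrite mule_ge0// lee_fin mulr_ge0// ltW.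
have := integral_displacement_le C1A mA phireg r0 K0 AK cV nuV a0 b0 (erefl M) Vab.
move=> /le_trans; apply; rewrite lee_wpmul2r//.
by rewrite lee_fin ler_wpM2r ?(ltW c0)// ler_nat.
Qed.
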